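(* Let $P\subseteq\mathbb{R}_+$ be a set of positive inner Lebesgue measure and let $q:P\to\mathbb{R}$ be an arbitrary function. If $f:\mathbb{R}_+\to\mathbb{R}_+$ is $(p,q(p))$-Jensen convex for all $p\in P$, i.e. \[ f\big(H_p(x,y)\big)\le H_{q(p)}\big(f(x),f(y)\big)\qquad(x,y>0,\ p\in P), \] then $f$ is continuous, and $f_{p,q(p)}$ is convex on $(\mathbb{R}_+)_p$ for all $p\in P$.
   Context: $\mathbb{R}_+=]0,\infty[$. For $p\in\mathbb{R}$, $H_p(x,y)=\left(\frac{x^p+y^p}{2}\right)^{1/p}$ if $p\neq0$ and $H_0(x,y)=\sqrt{xy}$ ($x,y>0$). For $f:\mathbb{R}_+\to\mathbb{R}_+$ and $(p,q)\in\mathbb{R}^2$ with $p\neq0$, set $(\mathbb{R}_+)_p=\{t^p\mid t>0\}$ and define $f_{p,q}:(\mathbb{R}_+)_p\to\mathbb{R}$ by $f_{p,q}(x)=\operatorname{sign}(q)\big(f(x^{1/p})\big)^q$ if $q\neq0$ and $f_{p,q}(x)=\log f(x^{1/p})$ if $q=0$. *)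

(* Defs.v *)
From HB Require Import structures.
From mathcomp Require Import all_boot all_order all_algebra.
From mathcomp Require Import all_classical all_reals all_analysis.
Set Implicit Arguments. Unset Strict Implicit. Unset Printing Implicit Defensive.
Import Order.TTheory GRing.Theory Num.Theory.
Import numFieldNormedType.Exports.
Local Open Scope classical_set_scope.
Local Open Scope ring_scope.

Definition Hmean (R : realType) (p x y : R) : R :=
  if p == 0 then Num.sqrt (x * y)
  else ((x `^ p + y `^ p) / 2) `^ p^-1.

Definition fpq (R : realType) (f : R -> R) (p q : R) (x : R) : R :=
  if q == 0 then ln (f (x `^ p^-1))
  else Num.sg q * (f (x `^ p^-1)) `^ q.

Definition Rplus_pow (R : realType) (p : R) : set R :=
  [set t `^ p | t in [set t : R | 0 < t]].

Definition convex_on (R : realType) (D : set R) (g : R -> R) : Prop :=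
  forall x y l, D x -> D y -> 0 <= l <= 1 ->
    g (l * x + (1 - l) * y) <= l * g x + (1 - l) * g y.

Definition inner_lebesgue (R : realType) (P : set R) : \bar R :=
  ereal_sup [set (@lebesgue_measure R) K | K in
               [set K : set R | measurable K /\ K `<=` P]].

(* Main.v *)
(* Every mean is at most the maximum, so [f <= max (f 1) (f e)] on the points
   [H_r(1, e)], [r] in [P]. Since [r |-> H_r(1, e)] expands distances on compact
   subsets of the half-line up to a positive factor, these points contain, in the
   coordinate [x ^ p], a measurable set of positive measure, whose sumset contains
   an interval (Steinhaus). Hence the midconvex function [f_{p,q(p)}] is bounded
   above on an interval, and is continuous and convex by Bernstein-Doetsch. Only
   the value of [q] at a fixed [p] matters, so [q] may be arbitrary. *)

Require Import Defs.
From HB Require Import structures.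
From mathcomp Require Import all_boot all_order all_algebra.
From mathcomp Require Import all_classical all_reals all_analysis.
From mathcomp Require Import measurable_realfun ring lra.
Import Order.TTheory GRing.Theory Num.Theory.
Import numFieldNormedType.Exports.
Local Open Scope classical_set_scope.
Local Open Scope ring_scope.

(** * Midconvex functions on the half-line: the Bernstein-Doetsch theorem *)

Definition midconvex {R : realType} (g : R -> R) : Prop :=
  forall x y : R, 0 < x -> 0 < y -> g ((x + y) / 2) <= (g x + g y) / 2.

Lemma exists_expVn_lt (R : realType) (e : R) :
  0 < e -> exists n : nat, (2 ^+ n)^-1 < e.
Proof.
move=> e0; exists (Num.bound e^-1).
rewrite invf_plt ?posrE ?exprn_gt0//.
have /ltW e'0 : 0 < e^-1 by rewrite invr_gt0.
apply: (lt_trans (archi_boundP e'0)).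
by rewrite -natrX ltr_nat ltn_expl.
Qed.

(** By induction: the point with weight 2^-(n+1) at [y] is the midpoint of [x] and the point with
    weight 2^-n at [y]. *)
Lemma midconvex_dyadic (R : realType) (g : R -> R) n (x y : R) :
  midconvex g -> 0 < x -> 0 < y ->
  g ((1 - (2 ^+ n)^-1) * x + (2 ^+ n)^-1 * y) <=
    (1 - (2 ^+ n)^-1) * g x + (2 ^+ n)^-1 * g y.
Proof.
move=> gJ x0 y0; elim: n => [|n IH].
  by rewrite expr0 invr1 subrr !mul0r !mul1r !add0r.
rewrite exprS invfM; set e := (2 ^+ n)^-1 in IH *.
have e0 : 0 < e by rewrite invr_gt0 exprn_gt0.
have e1 : e <= 1 by rewrite invf_le1 ?exprn_gt0// exprn_ege1// ler1n.
set z := (1 - e) * x + e * y in IH.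
have z0 : 0 < z.
  have := mulr_gt0 e0 y0; have : 0 <= (1 - e) * x.
    by rewrite mulr_ge0 ?subr_ge0// ltW.
  rewrite /z; lra.
have := gJ _ _ x0 z0.
have -> : (x + z) / 2 = (1 - 2^-1 * e) * x + 2^-1 * e * y.
  by rewrite /z; field.
move=> h; apply: (le_trans h); lra.
Qed.

(** With a fixed dyadic weight, every point near [x] combines one fixed [y] with a point sweeping
    ]a, b[, so the bound on that interval carries over to a neighbourhood of [x]. *)
Lemma midconvex_locally_bounded (R : realType) (g : R -> R) (a b M : R) :
  midconvex g -> 0 < a -> a < b -> (forall z, a < z < b -> g z <= M) ->
  forall x, 0 < x -> exists d M', 0 < d /\
    forall z, `|z - x| < d -> 0 < z /\ g z <= M'.
Proof.
move=> gJ a0 ab gM x x0; set c := (a + b) / 2.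
have c0 : 0 < c by rewrite /c; lra.
have [n] : exists n, (2 ^+ n)^-1 < Num.min (2^-1) (x / c).
  by apply: exists_expVn_lt; rewrite lt_min invr_gt0 ltr0n/= divr_gt0.
rewrite lt_min; set e := (2 ^+ n)^-1 => /andP[e2].
rewrite ltr_pdivlMr// => ecx.
have e0 : 0 < e by rewrite invr_gt0 exprn_gt0.
have e'0 : 0 < 1 - e by lra.
(* Solves x = (1 - e) y + e c; the choice e < x / c makes it positive. *)
pose y := (x - e * c) / (1 - e).
have y0 : 0 < y by rewrite divr_gt0// subr_gt0.
have ba0 : 0 < (b - a) / 2 by lra.
exists (Num.min x (e * ((b - a) / 2))), ((1 - e) * g y + e * M); split.
  by rewrite lt_min x0 mulr_gt0.
move=> z; rewrite lt_min => /andP[]; rewrite ltr_norml => /andP[z1 _] zx.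
split; first lra.
have {}zx : `|(z - x) / e| < (b - a) / 2.
  by rewrite normrM normfV (gtr0_norm e0) ltr_pdivrMr// mulrC.
have -> : z = (1 - e) * y + e * (c + (z - x) / e).
  by rewrite /y; field; rewrite !gt_eqF.
move: zx; rewrite ltr_norml; set w := (z - x) / e => /andP[w1 w2].
have aw : a < c + w by rewrite /c; lra.
have wb : c + w < b by rewrite /c; lra.
have := midconvex_dyadic _ g n y (c + w) gJ y0 (lt_trans a0 aw).
rewrite -/e => h; apply: (le_trans h); rewrite lerD2l ler_pM2l//.
by apply: gM; rewrite aw wb.
Qed.

(** The dyadic inequality turns the upper bound into g (x + h) - g x <= e (M - g x) for small h;
    midconvexity between x - h and x + h then yields the matching lower estimate. *)
Lemma midconvex_bounded_continuous (R : realType) (g : R -> R) (x d M : R) :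
  midconvex g -> 0 < d ->
  (forall z, `|z - x| < d -> 0 < z /\ g z <= M) -> {for x, continuous g}.
Proof.
move=> gJ d0 gM; apply/cvgrPdist_le => /= eps eps0.
have gxM : forall z, `|z - x| < d -> 0 < z by move=> z /gM[].
have [x0 gx] : 0 < x /\ g x <= M by apply: gM; rewrite subrr normr0.
(* Ensures e (M - g x) < eps; the added 1 keeps the divisor positive when M = g x. *)
have [n en] : exists n, (2 ^+ n)^-1 < eps / (M - g x + 1).
  by apply: exists_expVn_lt; rewrite divr_gt0//; lra.
move: en; set e := (2 ^+ n)^-1; rewrite ltr_pdivlMr; last lra.
move=> en.
have e0 : 0 < e by rewrite invr_gt0 exprn_gt0.
have up h : `|h| < e * d -> g (x + h) - g x <= eps.
  move=> hd.
  have hd' : `|(x + h / e) - x| < d.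
    by rewrite addrAC subrr add0r normrM normfV (gtr0_norm e0) ltr_pdivrMr// mulrC.
  have [p gp] := gM _ hd'.
  have := midconvex_dyadic _ g n x (x + h / e) gJ x0 p; rewrite -/e.
  have -> : (1 - e) * x + e * (x + h / e) = x + h by field; rewrite gt_eqF.
  have : e * g (x + h / e) <= e * M by rewrite ler_pM2l.
  nra.
have e1 : e <= 1 by rewrite invf_le1 ?exprn_gt0// exprn_ege1// ler1n.
have ed : e * d <= d by rewrite ler_piMl// ltW.
near=> z.
have zx : `|z - x| < e * d.
  rewrite distrC; near: z; exact: (nbhsx_ballx x _ (mulr_gt0 e0 d0)).
have zx' : `|- (z - x)| < e * d by rewrite normrN.
have := up _ zx; have := up _ zx'.
have p1 : 0 < x + - (z - x).
  apply: gxM; rewrite addrAC subrr add0r; exact: lt_le_trans ed.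
have p2 : 0 < z by apply: gxM; exact: lt_le_trans ed.
(* [x] is the midpoint of its mirror point 2x - z and [z], so g x - g z <= g (2x - z) - g x <=
   eps. *)
have := gJ _ _ p1 p2.
have -> : (x + - (z - x) + z) / 2 = x by field.
rewrite (_ : x + (z - x) = z); last by rewrite addrC subrK.
by move=> h1 h2 h3; rewrite ler_norml; apply/andP; split; lra.
Unshelve. all: by end_near. Qed.

(* At the minimum [m < 0] of the chord gap, reflecting through the nearer
   endpoint (where the gap vanishes) gives [m >= m / 2]. *)
Lemma midconvex_continuous_convex (R : realType) (g : R -> R) :
  midconvex g -> (forall x, 0 < x -> {for x, continuous g}) ->
  forall x y l, 0 < x -> 0 < y -> 0 <= l <= 1 ->
    g (l * x + (1 - l) * y) <= l * g x + (1 - l) * g y.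
Proof.
move=> gJ gC x y l x0 y0 l01.
pose s (t : R) : R := t * x + (1 - t) * y.
have s0 (t : R) : 0 <= t <= 1 -> 0 < s t.
  move=> /andP[t0 t1]; rewrite /s; have [->|tn0] := eqVneq t 0; first lra.
  have : 0 < t by rewrite lt_def tn0.
  move=> tp; have := mulr_gt0 tp x0.
  have : 0 <= (1 - t) * y by rewrite mulr_ge0 ?subr_ge0// ltW.
  lra.
(* The chord gap, midconcave because [g] is midconvex. *)
pose F (t : R) : R := t * g x + (1 - t) * g y - g (s t).
have Fmid (t u : R) : 0 <= t <= 1 -> 0 <= u <= 1 -> (F t + F u) / 2 <= F ((t + u) / 2).
  move=> t01 u01; have := gJ _ _ (s0 _ t01) (s0 _ u01).
  have -> : (s t + s u) / 2 = s ((t + u) / 2) by rewrite /s; field.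
  rewrite /F; lra.
have F0 : F 0 = 0 by rewrite /F /s !mul0r subr0 !mul1r !add0r subrr.
have F1 : F 1 = 0 by rewrite /F /s !mul1r subrr !mul0r !addr0 subrr.
have cF : {within `[0, 1], continuous F}.
  apply: continuous_in_subspaceT => t; rewrite inE/= in_itv/= => t01.
  have sC : s u @[u --> t] --> s t.
    apply: cvgD; apply: cvgMr_tmp; first exact: cvg_id.
    by apply: cvgB; [exact: cvg_cst | exact: cvg_id].
  have gsC : g (s u) @[u --> t] --> g (s t).
    exact: (cvg_comp _ _ sC (gC _ (s0 _ t01))).
  apply: cvgB gsC.
  apply: cvgD; apply: cvgMr_tmp; first exact: cvg_id.
  by apply: cvgB; [exact: cvg_cst | exact: cvg_id].
have [m] := EVT_min ler01 cF; rewrite in_itv/= => m01 mF.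
suff : 0 <= F m.
  by move=> /le_trans/(_ (mF l _)); rewrite in_itv /F /s subr_ge0; exact.
have I0 : 0 <= (0 : R) <= 1 by rewrite lexx ler01.
have I1 : 0 <= (1 : R) <= 1 by rewrite lexx ler01.
have [m2|m2] := leP m 2^-1.
  have J : 0 <= 2 * m <= 1 by move: m01 => /andP[? ?]; apply/andP; split; lra.
  have := Fmid _ _ I0 J; rewrite F0.
  have -> : (0 + 2 * m) / 2 = m by field.
  have := mF (2 * m); rewrite in_itv/= => /(_ J); lra.
have J : 0 <= 2 * m - 1 <= 1 by move: m01 => /andP[? ?]; apply/andP; split; lra.
have := Fmid _ _ I1 J; rewrite F1.
have -> : (1 + (2 * m - 1)) / 2 = m by field.
have := mF (2 * m - 1); rewrite in_itv/= => /(_ J); lra.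
Qed.

(** * Lipschitz images and the Steinhaus theorem for sumsets *)

(* [A] may be non-measurable: [lebesgue_measure] is the outer measure there. *)
Lemma lebesgue_measure_lipschitz_image (R : realType) (h : R -> R) (L : R)
    (A : set R) :
  0 < L -> {in A &, forall x y, `|h x - h y| <= L * `|x - y|} ->
  (lebesgue_measure (h @` A) <= L%:E * lebesgue_measure A)%E.
Proof.
move=> L0 hL; rewrite -lee_pdivrMl//.
rewrite [leRHS](_ : _ = (@wlength R idfun)^* A)%mu//.
(* It suffices to treat one cover [F] of [A] by open intervals, and there to compare interval by
   interval. *)
rewrite outer_measure_open_itv_cover.
apply: le_ereal_inf_tmp => _ /= [F [Fitv AF] <-].
rewrite lee_pdivrMl//.
have l0 k : (0 <= wlength (@idfun R) (F k))%E.
  by case: (Fitv k) => -[a b] ->; exact: wlength_ge0.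
have <- := @nneseriesZl R _ xpredT L 0 (fun k _ => l0 k).
have sub : h @` A `<=` \bigcup_k (h @` (A `&` F k)).
  move=> _ [x Ax <-]; have [k _ Fk] := AF _ Ax.
  by exists k => //; exists x.
apply: (le_trans (le_outer_measure ((@wlength R idfun)^*)%mu _ _ sub)).
apply: (le_trans (outer_measure_sigma_subadditive _ _)).
apply: lee_nneseries => [i _ _|k _]; first exact: outer_measure_ge0.
have [[a b]/= Fk] := Fitv k.
have [->|/set0P[_ [x0 [Ax0 Fx0] _]]] := eqVneq (h @` (A `&` F k)) set0.
  by rewrite outer_measure0 mule_ge0 ?l0// lee_fin ltW.
set S := h @` (A `&` F k); pose D := L * (b - a).
have ab : a < b.
  by move: Fx0; rewrite Fk/= in_itv/= => /andP[]; exact: lt_trans.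
(* [S] has diameter at most [D], so it lies in the interval of length [D] that starts at its
   infimum. *)
have SD u v : S u -> S v -> u - D <= v.
  move=> [x [Ax Fx] <-] [y [Ay Fy] <-].
  rewrite lerBlDr -lerBlDl (le_trans (ler_norm _))//.
  have /le_trans -> // := hL x y (mem_set Ax) (mem_set Ay).
  rewrite /D ler_pM2l//; move: Fx Fy; rewrite Fk/= !in_itv/=.
  by move=> /andP[? ?] /andP[? ?]; rewrite ler_norml; apply/andP; split; lra.
have S0 : S !=set0 by exists (h x0); exists x0.
have Slb : has_lbound S by exists (h x0 - D) => v Sv; apply: SD => //; exists x0.
have SI : S `<=` `[inf S, inf S + D].
  move=> u Su; rewrite /= in_itv/=; apply/andP; split.
    exact: ge_inf.
  by rewrite -lerBlDr; apply: lb_le_inf => // v Sv; exact: SD.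
apply: (le_trans (le_outer_measure ((@wlength R idfun)^*)%mu _ _ SI)).
rewrite [leLHS](_ : _ = lebesgue_measure `[inf S, inf S + D])//.
rewrite lebesgue_measure_itv/= lte_fin ltrDl /D mulr_gt0 ?subr_gt0//.
by rewrite Fk wlength_itv/= lte_fin ab -EFinD addrAC subrr add0r -EFinD EFinM.
Qed.

(** A reflection is 1-Lipschitz and its own inverse, so the Lipschitz bound applies in both
    directions. *)
Lemma lebesgue_measure_reflect (R : realType) (c : R) (A : set R) :
  lebesgue_measure ((fun x => c - x) @` A) = lebesgue_measure A.
Proof.
have le (B : set R) : (lebesgue_measure ((fun x => (c - x)%R) @` B) <= lebesgue_measure B)%E.
  rewrite -[leRHS]mul1e; apply: lebesgue_measure_lipschitz_image => //.
  by move=> x y _ _; rewrite mul1r distrC (_ : c - y - (c - x) = x - y)//; ring.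
apply/eqP; rewrite eq_le le/=; apply: le_trans (le _).
rewrite image_comp [X in (_ <= _ X)%E](_ : _ = A)//.
rewrite (_ : _ \o _ = id) ?image_id//; apply/funext => x /=.
by rewrite opprB addrC subrK.
Qed.

Lemma steinhaus_sumset (R : realType) (A : set R) :
  measurable A -> (0 < lebesgue_measure A)%E ->
  exists a b, a < b /\
    forall c, a < c < b -> exists x y, [/\ A x, A y & c = x + y].
Proof.
move=> mA A0.
(* Near a density point [x0], the mirror images [c - A] with [c] close to
   [2 * x0] must meet [A]. *)
have [x0 [Ax0 dx0]] : exists x0, A x0 /\
    (lebesgue_measure (A `&` ball x0 r) * (lebesgue_measure (ball x0 r))^-1)%E
      @[r --> 0^'+] --> 1%E.
  have [N [mN N0 sN]] := lebesgue_density mA.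
  apply: contrapT => nex.
  have AN : A `<=` N.
    move=> x Ax; apply: sN => /= dx; apply: nex; exists x; split=> //.
    by move: dx; rewrite indicE mem_set.
  have : (lebesgue_measure A <= lebesgue_measure N)%E.
    by apply: le_measure => //; rewrite inE.
  by rewrite leNgt => /negP; apply; rewrite (_ : lebesgue_measure N = 0%E).
(* 3/2 r is three quarters of the length 2r of the ball. Two disjoint sets of this measure exceed
   3r, the length of [ball x0 (3 / 2 * r)], where both will be shown to lie. *)
have [r [r0 hr]] : exists r, 0 < r /\
    ((3 / 2 * r)%:E < lebesgue_measure (A `&` ball x0 r))%E.
  have nb1 : nbhs 1%E [set y : \bar R | ((3 / 4)%:E < y)%E].
    apply: open_nbhs_nbhs; split; first exact: open_ereal_gt_ereal.
    by rewrite /= lte_fin; lra.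
  have near34 : \forall r \near 0^'+, ((3 / 4)%:E <
      lebesgue_measure (A `&` ball x0 r) * (lebesgue_measure (ball x0 r))^-1)%E.
    exact: dx0 nb1.
  have near0 := nbhs_right_gt (0 : R).
  have [r [h r0]] := filter_ex (filterI near34 near0).
  exists r; split=> //; move: h => /=.
  rewrite lebesgue_measure_ball ?ltW// inver gt_eqF ?mulrn_wgt0//.
  rewrite lte_pdivlMr ?mulrn_wgt0//.
  by rewrite -EFinM; congr (_%:E < _)%E; field.
exists (2 * x0 - r / 2), (2 * x0 + r / 2); split; first lra.
move=> c /andP[c1 c2]; apply: contrapT => nc.
set B := A `&` ball x0 r in hr.
have mB : measurable B by apply: measurableI => //; exact: measurable_ball.
pose s (x : R) : R := c - x.
have sE : s @` B = s @^-1` B.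
  apply/seteqP; split=> [_ [x Bx <-]|x Bx]; rewrite /s/=.
    by rewrite opprB addrC subrK.
  by exists (s x) => //; rewrite /s opprB addrC subrK.
have msB : measurable (s @` B).
  rewrite sE -[X in measurable X]setTI.
  have : measurable_fun setT s by apply: measurable_funB.
  exact.
(* A common point x = c - y would give c = x + y. *)
have disj : B `&` (s @` B) = set0.
  apply/seteqP; split=> // x [[Ax _] [y [Ay _] xy]]; apply: nc.
  by exists x, y; split=> //; rewrite -xy /s subrK.
(* The reflection moves the centre to c - x0, which is within r/2 of [x0]. *)
have sub : B `|` (s @` B) `<=` ball x0 (3 / 2 * r).
  move=> x; rewrite /ball/= => -[[_]|[y [_]]]; rewrite /ball/= ltr_norml => /andP[? ?].
    by rewrite ltr_norml; apply/andP; split; lra.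
  by rewrite /s => <-; rewrite ltr_norml; apply/andP; split; lra.
have : (lebesgue_measure (B `|` (s @` B)) <=
    lebesgue_measure (ball x0 (3 / 2 * r)))%E.
  apply: le_measure => //; rewrite inE; first exact: measurableU.
  exact: measurable_ball.
rewrite lebesgue_measure_ball; last by rewrite mulr_ge0// ltW.
have rB : lebesgue_measure (s @` B) = lebesgue_measure B.
  exact: lebesgue_measure_reflect.
rewrite measureU// [X in (_ + X)%E]rB leNgt => /negP; apply.
by rewrite mulr2n EFinD lteD.
Qed.

(** * Expansion of distances by the logarithm of H_r(1, e) *)

(* [ln H_r(1, e)] for [r != 0] (and [0] at [r = 0]). *)
Definition log_mean1e {R : realType} (r : R) : R := ln ((1 + expR r) / 2) / r.

Lemma Hmean_1e (R : realType) (r : R) :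
  r != 0 -> Hmean r 1 (expR 1) = expR (log_mean1e r).
Proof.
move=> r0; rewrite /Hmean (negbTE r0) powR1 -expRM mul1r /log_mean1e.
have w0 : 0 < (1 + expR r) / 2 by have := expR_gt0 r; lra.
by rewrite /powR gt_eqF// mulrC.
Qed.

Lemma log_mean1e_gt0 (R : realType) (r : R) : 0 < r -> 0 < log_mean1e r.
Proof.
move=> r0; rewrite divr_gt0// ln_gt0//.
have : 1 < expR r by rewrite expR_gt1.
lra.
Qed.

Lemma ln_lt_sub1 (R : realType) (z : R) : 0 < z -> z != 1 -> ln z < z - 1.
Proof.
move=> z0 z1; have := @expR_gt1Dx R (ln z).
by rewrite ln_eq0// lnK ?posrE// => /(_ z1); lra.
Qed.

(** This is positivity of the derivative of [log_mean1e]. With E = exp x and w = (1 + E) / 2, add ln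
    w < w - 1 to E times ln (w / E) < w / E - 1: the right-hand sides sum to 2w - 1 - E = 0. *)
Lemma ln_average1exp_lt (R : realType) (x : R) : 0 < x ->
  ln ((1 + expR x) / 2) < x * expR x / (1 + expR x).
Proof.
move=> x0; set E := expR x; set w := (1 + E) / 2.
have E1 : 1 < E by rewrite expR_gt1.
have wgt0 : 0 < w by rewrite /w; lra.
rewrite ltr_pdivlMr; last lra.
have h1 : ln w < w - 1 by apply: ln_lt_sub1 => //; rewrite gt_eqF// /w; lra.
have h2 : ln (w / E) < w / E - 1.
  apply: ln_lt_sub1; first by rewrite divr_gt0//; lra.
  by rewrite lt_eqF// ltr_pdivrMr /w; lra.
rewrite ln_div ?posrE ?expR_gt0// expRK in h2.
have : E * (ln w - x) < E * (w / E - 1) by rewrite ltr_pM2l//; lra.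
rewrite mulrBr mulrBr mulr1 [E * (w / E)]mulrC divfK; last by rewrite gt_eqF//; lra.
have : w = (1 + E) / 2 by [].
lra.
Qed.

Lemma is_derive_log_mean1e (R : realType) (x : R) : 0 < x ->
  is_derive x 1 log_mean1e
    ((x * expR x / (1 + expR x) - ln ((1 + expR x) / 2)) / x ^+ 2).
Proof.
move=> x0.
have E0 := expR_gt0 x.
have w0 : 0 < (1 + expR x) / 2 by lra.
have dw : is_derive x 1 (fun r : R => (1 + expR r) / 2) (expR x / 2).
  apply: is_derive_eq.
  by rewrite /= !scaler0 !add0r mul1r [RHS]mulrC.
have dl : is_derive x 1 (fun r : R => ln ((1 + expR r) / 2))
    (((1 + expR x) / 2)^-1 * (expR x / 2)).
  have d := @is_derive1_comp R (@ln R) _ x _ _ (is_derive1_ln w0) dw; exact: d.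
have dv : is_derive x 1 (fun r : R => r^-1) (- x ^- 2).
  have d := @is_deriveV R id x 1 1 (lt0r_neq0 x0) (is_derive_id _ _).
  by apply: (is_derive_eq d); rewrite /= -[LHS]/(- x ^- 2 * 1) mulr1.
have d := is_deriveM dl dv; apply: (is_derive_eq d) => /=.
rewrite -[X in X + _ = _]/(_ * _) -[X in _ + X = _]/(_ * _).
field; rewrite !gt_eqF//; lra.
Qed.

(** The slope of exp is at least 1 on the nonnegative half-line. *)
Lemma expR_expand (R : realType) (x y : R) :
  0 <= x -> 0 <= y -> `|x - y| <= `|expR x - expR y|.
Proof.
wlog xy : x y / x <= y.
  move=> W x0 y0; have [|/ltW] := leP x y => h; first exact: W.
  by rewrite distrC [leRHS]distrC; exact: W.
move=> x0 y0; rewrite ler0_norm ?subr_le0// ler0_norm ?subr_le0 ?ler_expR//.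
have h1 := expR_ge1Dx (y - x).
have h2 := expR_ge1Dx x.
have -> : expR y = expR x * expR (y - x) by rewrite -expRD addrC subrK.
nra.
Qed.

(** The derivative is continuous and positive, so its minimum over [a, b] serves as [c] in the mean
    value theorem. *)
Lemma log_mean1e_expand (R : realType) (a b : R) : 0 < a -> a <= b ->
  exists c, 0 < c /\ {in `[a, b] &, forall r s,
    c * `|r - s| <= `|log_mean1e r - log_mean1e s|}.
Proof.
move=> a0 ab.
pose D (x : R) : R :=
  (x * expR x / (1 + expR x) - ln ((1 + expR x) / 2)) / x ^+ 2.
have D0 x : 0 < x -> 0 < D x.
  by move=> x0; rewrite divr_gt0 ?exprn_gt0// subr_gt0 ln_average1exp_lt.
have cD : {within `[a, b], continuous D}.
  apply: continuous_in_subspaceT => x; rewrite inE/= in_itv/= => /andP[ax xb].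
  have x0 : 0 < x by lra.
  have E0 := expR_gt0 x.
  have w0 : 0 < (1 + expR x) / 2 by lra.
  have cE : expR u @[u --> x] --> expR x by exact: continuous_expR.
  have c1E : 1 + expR u @[u --> x] --> 1 + expR x.
    by apply: cvgD => //; exact: cvg_cst.
  have cw : (1 + expR u) / 2 @[u --> x] --> (1 + expR x) / 2.
    by apply: cvgM => //; exact: cvg_cst.
  apply: cvgM.
    apply: cvgB; last exact: (cvg_comp _ _ cw (continuous_ln w0)).
    apply: cvgM; first by apply: cvgM => //; exact: cvg_id.
    by apply: cvgV => //; rewrite gt_eqF//; lra.
  apply: cvgV; first by rewrite expf_neq0// gt_eqF.
  by apply: cvgM; exact: cvg_id.
have [m] := EVT_min ab cD; rewrite in_itv/= => /andP[am mb] mD.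
have m0 : 0 < m by lra.
exists (D m); split; first exact: D0.
move=> r s.
wlog rs : r s / r <= s.
  move=> W r0 s0; have [|/ltW] := leP r s => h; first exact: W.
  by rewrite distrC [leRHS]distrC; exact: W.
rewrite !in_itv/= => /andP[ar rb] /andP[as_ sb].
have der x : x \in `[r, s] -> is_derive x 1 log_mean1e (D x).
  by rewrite in_itv/= => /andP[? ?]; apply: is_derive_log_mean1e; lra.
have der' : forall x, x \in `]r, s[ -> is_derive x 1 log_mean1e (D x).
  by move=> x /subset_itv_oo_cc; exact: der.
have cu : {within `[r, s], continuous log_mean1e}.
  by apply: derivable_within_continuous => x /der[].
have [z] := MVT_segment rs der' cu.
rewrite in_itv/= => /andP[rz zs] e.
have mz : D m <= D z by apply: mD; rewrite in_itv/=; apply/andP; split; lra.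
rewrite distrC [leRHS]distrC e normrM [`|s - r|]ger0_norm ?subr_ge0//.
by rewrite ler_wpM2r ?subr_ge0// (le_trans mz)// ler_norm.
Qed.

(** * Power means and the transforms that linearise them *)

(* [qtransform q] turns the mean [H_q] into the arithmetic mean, and
   [f_{p,q} x = qtransform q (f (x `^ p^-1))]. *)
Definition qtransform {R : realType} (q t : R) : R :=
  if q == 0 then ln t else Num.sg q * t `^ q.

Definition qtransform_inv {R : realType} (q u : R) : R :=
  if q == 0 then expR u else (Num.sg q * u) `^ q^-1.

Lemma powR_expR (R : realType) (t q : R) : 0 < t -> t `^ q = expR (q * ln t).
Proof. by move=> t0; rewrite /powR gt_eqF. Qed.

Lemma powRVK (R : realType) (q t : R) : q != 0 -> 0 < t -> (t `^ q^-1) `^ q = t.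
Proof. by move=> q0 t0; rewrite -powRrM mulVf// powRr1// ltW. Qed.

Lemma powRK (R : realType) (q t : R) : q != 0 -> 0 < t -> (t `^ q) `^ q^-1 = t.
Proof. by move=> q0 t0; rewrite -powRrM mulfV// powRr1// ltW. Qed.

Lemma Hmean_gt0 (R : realType) (q a b : R) : 0 < a -> 0 < b -> 0 < Hmean q a b.
Proof.
move=> a0 b0; rewrite /Hmean; case: ifPn => q0; first by rewrite sqrtr_gt0 mulr_gt0.
by rewrite powR_gt0// divr_gt0// addr_gt0// powR_gt0.
Qed.

(** For q < 0 the power decreases, and the factor [Num.sg q] restores monotonicity. *)
Lemma qtransform_lt (R : realType) (q s t : R) :
  0 < s -> s < t -> qtransform q s < qtransform q t.
Proof.
move=> s0 st; have t0 := lt_trans s0 st.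
have lst : ln s < ln t by rewrite ltr_ln.
rewrite /qtransform !powR_expR//; case: (ltgtP q 0) => [q0|q0|//].
  by rewrite ltr0_sg// !mulN1r ltrN2 ltr_expR ltr_nM2l.
by rewrite gtr0_sg// !mul1r ltr_expR ltr_pM2l.
Qed.

Lemma qtransform_le (R : realType) (q s t : R) :
  0 < s -> s <= t -> qtransform q s <= qtransform q t.
Proof.
move=> s0; rewrite le_eqVlt => /predU1P[->//|st].
by rewrite ltW// qtransform_lt.
Qed.

Lemma qtransform_Hmean (R : realType) (q a b : R) : 0 < a -> 0 < b ->
  qtransform q (Hmean q a b) = (qtransform q a + qtransform q b) / 2.
Proof.
move=> a0 b0; rewrite /qtransform /Hmean; case: (eqVneq q 0) => q0.
  rewrite -powR12_sqrt ?mulr_ge0 ?ltW// ln_powR lnM ?posrE//.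
  by rewrite mulrC.
rewrite powRVK//; first by rewrite mulrA mulrDr.
by rewrite divr_gt0// addr_gt0// powR_gt0.
Qed.

(** After the increasing transform, this says that an arithmetic mean does not exceed both of its
    terms. *)
Lemma Hmean_le_max (R : realType) (q a b : R) :
  0 < a -> 0 < b -> Hmean q a b <= Num.max a b.
Proof.
move=> a0 b0; rewrite leNgt; apply/negP => H.
have m0 : 0 < Num.max a b by rewrite lt_max a0.
have := qtransform_lt _ q _ _ m0 H; rewrite qtransform_Hmean//.
have := qtransform_le _ q a (Num.max a b) a0; rewrite le_max lexx => /(_ isT).
have := qtransform_le _ q b (Num.max a b) b0; rewrite le_max lexx orbT => /(_ isT).
lra.
Qed.

Lemma qtransformK (R : realType) (q t : R) :
  0 < t -> qtransform_inv q (qtransform q t) = t.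
Proof.
move=> t0; rewrite /qtransform_inv /qtransform; case: (eqVneq q 0) => q0.
  by rewrite lnK ?posrE.
by rewrite mulrA -expr2 sqr_sg q0 mul1r powRK.
Qed.

Lemma continuous_powR (R : realType) (q t : R) :
  0 < t -> {for t, continuous (fun u => u `^ q)}.
Proof.
move=> t0; have [d _] := is_derive1_powR q t0.
by apply: differentiable_continuous; exact/derivable1_diffP.
Qed.

(** At a value of [qtransform q] with q nonzero, the two signs cancel and the outer power is taken
    at t ^ q > 0, where powers are continuous. *)
Lemma continuous_qtransform_inv (R : realType) (q t : R) :
  0 < t -> {for qtransform q t, continuous (qtransform_inv q)}.
Proof.
move=> t0; rewrite /qtransform_inv /qtransform; case: (eqVneq q 0) => q0.
  exact: continuous_expR.
have e : Num.sg q * (Num.sg q * t `^ q) = t `^ q.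
  by rewrite mulrA -expr2 sqr_sg q0 mul1r.
have c1 : Num.sg q * u @[u --> Num.sg q * t `^ q] --> Num.sg q * (Num.sg q * t `^ q).
  by apply: cvgM; [exact: cvg_cst | exact: cvg_id].
rewrite e in c1; rewrite /prop_for /continuous_at /= e.
exact: (cvg_comp _ _ c1 (continuous_powR _ q^-1 _ (powR_gt0 q t0))).
Qed.

Lemma fpqE (R : realType) (f : R -> R) (p q x : R) :
  fpq f p q x = qtransform q (f (x `^ p^-1)).
Proof. by []. Qed.

(** The H_p mean of x ^ (1/p) and y ^ (1/p) is ((x + y) / 2) ^ (1/p); applying the increasing
    [qtransform q] to the Jensen inequality there makes its right-hand side an arithmetic mean. *)
Lemma fpq_midconvex (R : realType) (f : R -> R) (p q : R) :
  p != 0 -> (forall x, 0 < x -> 0 < f x) ->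
  (forall x y, 0 < x -> 0 < y -> f (Hmean p x y) <= Hmean q (f x) (f y)) ->
  midconvex (fpq f p q).
Proof.
move=> p0 f0 fJ x y x0 y0; rewrite !fpqE.
have x'0 := powR_gt0 p^-1 x0; have y'0 := powR_gt0 p^-1 y0.
rewrite -qtransform_Hmean ?f0//; apply: qtransform_le.
  by rewrite f0// powR_gt0//; lra.
by have := fJ _ _ x'0 y'0; rewrite {1}/Hmean (negbTE p0) !powRVK.
Qed.

(** * Compact sets of exponents and their images *)

(** Inner regularity replaces a measurable subset by a compact one; compactness later confines the
    exponents to some [a, b] with a > 0 and makes the image measurable. *)
Lemma inner_lebesgue_gt0_compact (R : realType) (P : set R) :
  (0 < inner_lebesgue P)%E ->
  exists K : set R, [/\ compact K, K `<=` P & (0 < lebesgue_measure K)%E].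
Proof.
move=> /ereal_sup_gt[_ [K [mK KP] <-]].
rewrite lebesgue_regularity_inner_sup// => /ereal_sup_gt[_ [V [cV VK] <-] V0].
by exists V; split=> //; exact: subset_trans KP.
Qed.

(** The map is H_r(1, e) ^ p. It expands distances on [K], so its inverse is Lipschitz and carries
    the image back onto [K]; a null image would make [K] null. *)
Lemma log_mean1e_image_gt0 (R : realType) (K : set R) (p : R) :
  0 < p -> compact K -> K `<=` [set r | 0 < r] ->
  (0 < lebesgue_measure K)%E ->
  measurable ((fun r => expR (p * log_mean1e r)) @` K) /\
  (0 < lebesgue_measure ((fun r => expR (p * log_mean1e r)) @` K))%E.
Proof.
move=> p0 cK K0 mK; set h := fun r => _.
have Kn0 : K !=set0.
  by apply/set0P/eqP => K00; move: mK; rewrite K00 measure0 ltxx.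
have cid : {within K, continuous (@idfun R)}.
  by apply: continuous_subspaceT => x; exact: cvg_id.
have [a aK aP] := compact_EVT_min Kn0 cK cid.
have [b bK bP] := compact_EVT_max Kn0 cK cid.
have a0 : 0 < a by apply: K0; rewrite -inE.
have Kab r : K r -> r \in `[a, b].
  by move=> /mem_set Kr; rewrite in_itv/= aP ?bP.
have ab : a <= b by exact: aP.
have [c [c0 hc]] := log_mean1e_expand _ _ _ a0 ab.
have cpt : compact (h @` K).
  apply: continuous_compact => //; apply: continuous_in_subspaceT => r.
  rewrite inE => /K0/= r0.
  apply: (continuous_comp (f := fun r => p * log_mean1e r)); last exact: continuous_expR.
  apply: cvgM; first exact: cvg_cst.
  have [d _] := is_derive_log_mean1e _ _ r0.
  by apply: differentiable_continuous; exact/derivable1_diffP.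
split; first exact: compact_measurable.
have hexp : {in K &, forall r s, p * c * `|r - s| <= `|h r - h s|}.
  move=> r s; rewrite !inE => Kr Ks.
  (* [expR_expand] requires nonnegative exponents. *)
  have pu t : K t -> 0 <= p * log_mean1e t.
    by move=> /K0/= t0; rewrite mulr_ge0 ?ltW// log_mean1e_gt0.
  apply: le_trans (expR_expand _ _ _ (pu _ Kr) (pu _ Ks)).
  by rewrite -mulrBr normrM (gtr0_norm p0) -mulrA ler_pM2l// hc// Kab.
have pc0 : 0 < p * c by rewrite mulr_gt0.
have hinj : {in K &, injective h}.
  move=> r s Kr Ks hrs; have := hexp r s Kr Ks.
  rewrite hrs subrr normr0 pmulr_rle0// normr_le0 subr_eq0 => /eqP//.
pose k := fun y => xget 0 [set r | K r /\ h r = y].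
have kh r : K r -> k (h r) = r.
  move=> Kr; rewrite /k; case: xgetP => [s _ [Ks hs]|/(_ r)[]//].
  by apply: hinj => //; rewrite inE.
have kK : k @` (h @` K) = K.
  apply/seteqP; split=> [_ [_ [r Kr <-] <-]|r Kr]; first by rewrite kh.
  by exists (h r); [exists r | exact: kh].
have := @lebesgue_measure_lipschitz_image R k (p * c)^-1 (h @` K).
rewrite invr_gt0 kK => /(_ pc0); rewrite lt0e measure_ge0 andbT => le.
apply/eqP => h0.
have : (lebesgue_measure K <= (p * c)^-1%:E * lebesgue_measure (h @` K))%E.
  apply: le => x y; rewrite !inE => -[r Kr <-] [s Ks <-].
  by rewrite !kh// ler_pdivlMl// hexp// inE.
by rewrite h0 mule0 leNgt mK.
Qed.

(** * Continuity of f_{p,q(p)} and the final theorem *)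

Lemma fpq_continuous (R : realType) (P : set R) (q : R -> R) (f : R -> R) :
  P `<=` [set p : R | 0 < p] ->
  (0 < inner_lebesgue P)%E ->
  (forall x : R, 0 < x -> 0 < f x) ->
  (forall p x y : R, P p -> 0 < x -> 0 < y ->
     f (Hmean p x y) <= Hmean (q p) (f x) (f y)) ->
  forall p x, P p -> 0 < x -> {for x, continuous (fpq f p (q p))}.
Proof.
move=> P0 muP f0 fJ p x Pp x0.
have p0 : 0 < p := P0 _ Pp.
have pn0 : p != 0 by rewrite gt_eqF.
have gJ := fpq_midconvex _ f p (q p) pn0 f0 (fun x y => fJ p x y Pp).
have [K [cK KP mK]] := inner_lebesgue_gt0_compact _ _ muP.
have [mA A0] := log_mean1e_image_gt0 _ _ _ p0 cK (subset_trans KP P0) mK.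
set A := _ @` K in mA A0.
have [a [b [ab sum]]] := steinhaus_sumset _ _ mA A0.
have e0 : 0 < expR (1 : R) by exact: expR_gt0.
(* For z = H_r(1, e) ^ p the value f (z ^ (1/p)) is f (H_r(1, e)), at most H_{q(r)}(f 1, f e), hence
   at most the maximum of f 1 and f e, a bound free of q(r). *)
have [M gA] : exists M, forall z, A z -> 0 < z /\ fpq f p (q p) z <= M.
  exists (qtransform (q p) (Num.max (f 1) (f (expR 1)))) => z [r Kr <-].
  split; first exact: expR_gt0.
  have r0 : 0 < r := P0 _ (KP _ Kr).
  rewrite fpqE mulrC expRM powRK ?expR_gt0// -Hmean_1e ?gt_eqF//.
  apply: qtransform_le; first by rewrite f0// Hmean_gt0.
  by apply: le_trans (fJ r _ _ (KP _ Kr) _ _) _ => //; apply: Hmean_le_max; exact: f0.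
(* Such a [z] is the midpoint of two points of [A], so midconvexity passes the bound on to it. *)
have gM z : a / 2 < z < b / 2 -> 0 < z /\ fpq f p (q p) z <= M.
  move=> /andP[az zb].
  have [|u [v [/gA[u0 gu] /gA[v0 gv] e]]] := sum (2 * z).
    by apply/andP; split; lra.
  have -> : z = (u + v) / 2 by rewrite -e; field.
  split; first by rewrite divr_gt0// addr_gt0.
  apply: (le_trans (gJ _ _ u0 v0)).
  rewrite ler_pdivrMr ?ltr0n// mulr_natr mulr2n; exact: lerD gu gv.
(* The sign of [a] is unknown, so the left end of the interval is moved to its centre, which is
   positive as a midpoint of points of [A]. *)
have c0 : 0 < (a + b) / 4.
  by have [|//] := gM ((a + b) / 4); apply/andP; split; lra.
have cb : (a + b) / 4 < b / 2 by lra.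
have gM' z : (a + b) / 4 < z < b / 2 -> fpq f p (q p) z <= M.
  by move=> /andP[? ?]; apply: (gM z _).2; apply/andP; split; lra.
have [d [M' [d0 dM]]] := midconvex_locally_bounded _ _ _ _ _ gJ c0 cb gM' _ x0.
exact: midconvex_bounded_continuous gJ d0 dM.
Qed.

Theorem theorem6 (R : realType) (P : set R) (q : R -> R) (f : R -> R) :
  P `<=` [set p : R | 0 < p] ->
  (0 < inner_lebesgue P)%E ->
  (forall x : R, 0 < x -> 0 < f x) ->
  (forall p x y : R, P p -> 0 < x -> 0 < y ->
     f (Hmean p x y) <= Hmean (q p) (f x) (f y)) ->
  (forall x : R, 0 < x -> {for x, continuous f}) /\
  (forall p : R, P p -> convex_on (Rplus_pow p) (fpq f p (q p))).
Proof.
move=> P0 muP f0 fJ.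
have gC := fpq_continuous _ _ _ _ P0 muP f0 fJ.
split=> [x x0|p Pp]; last first.
  have pn0 : p != 0 by rewrite gt_eqF//; exact: P0.
  move=> _ _ l [s /= s0 <-] [t /= t0 <-] l01.
  apply: midconvex_continuous_convex; rewrite ?powR_gt0//.
    by apply: fpq_midconvex => // x y; exact: fJ.
  by move=> x; exact: gC.
have [K [_ KP mK]] := inner_lebesgue_gt0_compact _ _ muP.
have [p Kp] : K !=set0.
  by apply/set0P/eqP => K00; move: mK; rewrite K00 measure0 ltxx.
have Pp := KP _ Kp; have p0 : 0 < p := P0 _ Pp.
have pn0 : p != 0 by rewrite gt_eqF.
have xp0 := powR_gt0 p x0.
(* Recovers [f] from f_{p,q(p)} by composing with two continuous maps. *)
have fE u : 0 < u -> qtransform_inv (q p) (fpq f p (q p) (u `^ p)) = f u.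
  by move=> u0; rewrite fpqE powRK// qtransformK// f0.
have cg := gC _ _ Pp xp0.
have ch : {for fpq f p (q p) (x `^ p), continuous (qtransform_inv (q p))}.
  by rewrite fpqE; apply: continuous_qtransform_inv; rewrite f0// powR_gt0.
(* Keeps unification from unfolding these two functions. *)
move: (fpq f p (q p)) (qtransform_inv (q p)) fE cg ch => g h fE cg ch.
have c1 : g (u `^ p) @[u --> x] --> g (x `^ p).
  exact: (cvg_comp _ _ (continuous_powR _ p _ x0) cg).
have c2 : h (g (u `^ p)) @[u --> x] --> h (g (x `^ p)).
  exact: (cvg_comp _ _ c1 ch).
rewrite (fE _ x0) in c2.
(* The composition agrees with [f] at positive points, hence near [x]. *)
apply: cvg_trans c2; apply: near_eq_cvg; near=> u.
have u0 : 0 < u by near: u; exact: lt_nbhsr.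
exact: fE.
Unshelve. all: by end_near. Qed.
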